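(* Let $(\Phi,G)$ be a generalized metric CRF-structure on $M$ with the associated structures $(F_\pm,\gamma,\psi)$. Then $(\Phi,G)$ is a generalized CRFK-structure if and only if $(F_+,\gamma)$ and $(F_-,\gamma)$ are classical metric CRF-structures and the equalities $$i(X\wedge Y)d\psi=\pm\,(i(X)L_Y\gamma-L_Xi(Y)\gamma)$$ hold for either $X,Y\in H_\pm$ or $X\in H_\pm,\ Y\in Q_\pm$ (with corresponding signs).
   Context: $M$ is a $C^\infty$ manifold, $T^{big}M=TM\oplus T^*M$ with $g((X,\alpha),(Y,\beta))=\frac12(\alpha(Y)+\beta(X))$ and Courant bracket $[(X,\alpha),(Y,\beta)]=([X,Y],L_X\beta-L_Y\alpha+\frac12 d(\alpha(Y)-\beta(X)))$, extended complex (bi)linearly. A generalized F-structure is a $g$-skew-symmetric endomorphism $\Phi$ of $T^{big}M$ with $\Phi^3+\Phi=0$; it is CRF if the sections of its $\sqrt{-1}$-eigenbundle $E\subseteq T^{big}M\otimes\mathbb{C}$ are closed under the Courant bracket; $S=\ker\Phi$. A generalized Riemannian metric is a positive definite metric $G$ on $T^{big}M$ such that $\sharp_G$ defined by $2g(\sharp_G\mathcal{X},\mathcal{Y})=G(\mathcal{X},\mathcal{Y})$ satisfies $\sharp_G^2=Id$ and preserves $g$. $G$ is equivalent to a pair $(\gamma,\psi)$ (Riemannian metric, $2$-form) such that the $(\pm1)$-eigenbundles of $\sharp_G$ are $V_\pm=\{(X,\flat_{\psi\pm\gamma}X)\,/\,X\in TM\}$, $\flat_\tau X=i(X)\tau$;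 $\tau_\pm=pr_{TM}|_{V_\pm}$ are isomorphisms onto $TM$. $(\Phi,G)$ is a generalized metric F-structure (metric CRF-structure, if $\Phi$ is CRF) if $G(\Phi\mathcal{X},\mathcal{Y})+G(\mathcal{X},\Phi\mathcal{Y})=0$; then $\Phi$ preserves $V_\pm$ and $F_\pm=\tau_\pm\circ\Phi|_{V_\pm}\circ\tau_\pm^{-1}$ satisfy $F_\pm^3+F_\pm=0$ and are $\gamma$-skew-symmetric. Put $E_\pm=V_\pm\cap E$, $S_\pm=V_\pm\cap S$ (bundles complexified as needed). $(\Phi,G)$ is a generalized CRFK-structure if $[E_\pm,E_\pm]\subseteq E_\pm$ and $[E_\pm,S_\pm]\subseteq E_\pm\oplus S_\pm$ (Courant brackets of sections, same sign throughout). $H_\pm,\bar H_\pm,Q_\pm$ are the eigenbundles of $F_\pm$ in $TM\otimes\mathbb{C}$ for the eigenvalues $\sqrt{-1},-\sqrt{-1},0$. $(F_\pm,\gamma)$ is a classical metric CRF-structure if, besides $F_\pm^3+F_\pm=0$ and $\gamma$-skew-symmetry, $[H_\pm,H_\pm]\subseteq H_\pm$ and $[H_\pm,Q_\pm]\subseteq H_\pm\oplus Q_\pm$ (Lie brackets). $X,Y$ denote sections of the indicated bundles; $i(X\wedge Y)d\psi=d\psi(X,Y,\cdot)$; $i(Y)\gamma=\gamma(Y,\cdot)$; $L_Xi(Y)\gamma=L_X(i(Y)\gamma)$; every formula with $\pm$ stands for two formulas. *)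

(* Defs.v *)
(* Generalized CRF geometry on C^oo manifolds, over MathComp-Analysis.

   All bundles are handled through their modules of global C^oo sections over
   the ring C^oo(M): a vector field is a derivation of C^oo(M), a 1-form is a
   C^oo(M)-linear map from vector fields to C^oo(M), and bundle morphisms and
   tensor fields are C^oo(M)-(multi)linear maps between sections.  M being
   Hausdorff and second countable, these are exactly the smooth vector fields,
   forms, endomorphisms and tensors.  A subbundle is given by the predicate
   that singles out its sections. *)
From HB Require Import structures.
From mathcomp Require Import all_boot all_order all_algebra.
From mathcomp Require Import boolp classical_sets functions cardinality reals.
From mathcomp Require Import topology normedtype derive.
From mathcomp Require Import ring.

Set Implicit Arguments.
Unset Strict Implicit.
Unset Printing Implicit Defensive.
Import Order.TTheory GRing.Theory Num.Theory.
Import numFieldNormedType.Exports.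
Local Open Scope classical_set_scope.
Local Open Scope ring_scope.

Section Smooth.
Context {R : realType} {V W : normedModType R}.

(* C^k on an open set U: continuous, with C^(k-1) directional derivatives. *)
Fixpoint Ck_on (k : nat) (U : set V) (f : V -> W) : Prop :=
  (forall x, U x -> {for x, continuous f}) /\
  match k with
  | 0%N => True
  | k'.+1 => forall v, (forall x, U x -> derivable f x v) /\
                       Ck_on k' U (fun x => 'D_v f x)
  end.

Definition smooth_on (U : set V) (f : V -> W) : Prop :=
  forall k, Ck_on k U f.

Lemma Ck_ext k (U : set V) (f g : V -> W) : open U ->
  (forall x, U x -> f x = g x) -> Ck_on k U f -> Ck_on k U g.
Proof.
move=> Uo; have nearU x (P : V -> Prop) : U x -> (forall y, U y -> P y) ->
    \near x, P x.
  by move=> Ux UP; apply: filterS (open_nbhs_nbhs (conj Uo Ux)).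
elim: k f g => [|k IH] f g fg /= [fc fd]; split.
- move=> x Ux; rewrite /prop_for /continuous_at -(fg _ Ux).
  apply: cvg_trans (fc x Ux); apply: near_eq_cvg.
  by apply: nearU.
- by [].
- move=> x Ux; rewrite /prop_for /continuous_at -(fg _ Ux).
  apply: cvg_trans (fc x Ux); apply: near_eq_cvg.
  by apply: nearU.
- move=> v; have [fdv fk] := fd v; split.
    by move=> x Ux; apply: near_eq_derivable (fdv x Ux); apply: nearU.
  apply: IH fk => x Ux; apply: near_eq_derive.
  by apply: nearU.
Qed.

Lemma Ck_cst k (U : set V) (c : W) : Ck_on k U (cst c).
Proof.
elim: k c => [|k IH] c /=; split => //; first by move=> x _; exact: cst_continuous.
- by move=> x _; exact: cst_continuous.
move=> v; split => [x _|]; first exact: derivable_cst.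
rewrite (_ : (fun _ => _) = cst 0) //.
by apply/funext => x; rewrite derive_cst.
Qed.

Lemma Ck_lin k (U : set V) (a : R) (f g : V -> W) : open U ->
  Ck_on k U f -> Ck_on k U g -> Ck_on k U (a *: f + g).
Proof.
move=> Uo.
have cc (u w : V -> W) x : {for x, continuous u} -> {for x, continuous w} ->
    {for x, continuous (a *: u + w)}.
  by move=> uc wc; apply: cvgD => //; apply: cvgZr.
elim: k f g => [|k IH] f g /= [fc fd] [gc gd]; split => //.
- by move=> x Ux; apply: cc; [exact: fc | exact: gc].
- by move=> x Ux; apply: cc; [exact: fc | exact: gc].
move=> v; have [fdv fk] := fd v; have [gdv gk] := gd v; split.
  by move=> x Ux; apply: derivableD; [apply: derivableZ; exact: fdv | exact: gdv].
apply: (Ck_ext Uo _ (IH _ _ fk gk)) => x Ux /=.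
rewrite deriveD; last exact: gdv.
  by rewrite deriveZ //; exact: fdv.
by apply: derivableZ; exact: fdv.
Qed.

Lemma CkS k (U : set V) (f : V -> W) : Ck_on k.+1 U f -> Ck_on k U f.
Proof.
elim: k f => [|k IH] f [fc fd]; first by split.
split=> // v; have [fdv fk] := fd v.
by split=> //; apply: IH.
Qed.

End Smooth.

Lemma Ck_mul {R : realType} {V : normedModType R} k (U : set V) (f g : V -> R) :
  open U -> Ck_on k U f -> Ck_on k U g -> Ck_on k U (f * g).
Proof.
move=> Uo; elim: k f g => [|k IH] f g fC gC.
  case: fC gC => [fc _] [gc _]; split => // x Ux.
  by apply: continuousM; [exact: fc | exact: gc].
have fk := CkS fC; have gk := CkS gC.
case: fC gC => [fc fd] [gc gd]; split => [x Ux|v].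
  by apply: continuousM; [exact: fc | exact: gc].
have [fdv dfk] := fd v; have [gdv dgk] := gd v; split.
  by move=> x Ux; apply: derivableM; [exact: fdv | exact: gdv].
apply: (Ck_ext Uo _ (Ck_lin 1 Uo (IH _ _ fk dgk) (IH _ _ gk dfk))) => x Ux.
by rewrite deriveM ?scale1r //; [exact: fdv | exact: gdv].
Qed.

(* A homeomorphism between an open subset of M and an open subset of R^n. *)
Record chart (R : realType) (n : nat) (M : topologicalType) := Chart {
  chart_dom : set M;
  chart_im : set 'rV[R]_n;
  chart_to : M -> 'rV[R]_n;
  chart_from : 'rV[R]_n -> M;
  chart_dom_open : open chart_dom;
  chart_im_open : open chart_im;
  chart_to_im : forall x, chart_dom x -> chart_im (chart_to x);
  chart_from_dom : forall u, chart_im u -> chart_dom (chart_from u);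
  chart_toK : forall x, chart_dom x -> chart_from (chart_to x) = x;
  chart_fromK : forall u, chart_im u -> chart_to (chart_from u) = u;
  chart_to_cont : forall x, chart_dom x -> {for x, continuous chart_to};
  chart_from_cont : forall u, chart_im u -> {for u, continuous chart_from}
}.

Record smooth_manifold (R : realType) (n : nat) := SmoothManifold {
  mcarrier :> topologicalType;
  atlas : set (chart R n mcarrier);
  manifold_hausdorff : hausdorff_space mcarrier;
  manifold_second_countable : @second_countable mcarrier;
  atlas_cover : forall x, exists2 c, atlas c & chart_dom c x;
  atlas_compatible : forall c c', atlas c -> atlas c' ->
    smooth_on (chart_im c `&` chart_from c @^-1` chart_dom c')
              (chart_to c' \o chart_from c)
}.

Section SmoothFunctions.
Context {R : realType} {n : nat} (M : smooth_manifold R n).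

Definition smooth_fun (f : M -> R) : Prop :=
  forall c, atlas c -> smooth_on (chart_im c) (f \o chart_from c).

(* C^oo(M), as a subring (and R-submodule) of M -> R. *)
Record cinf := Cinf { cinf_val :> M -> R ; _ : `[< smooth_fun cinf_val >] }.

HB.instance Definition _ := [isSub for cinf_val].
HB.instance Definition _ := [Choice of cinf by <:].

Lemma smooth_fun_cst (a : R) : smooth_fun (cst a).
Proof. by move=> c _ k; exact: Ck_cst. Qed.

Lemma smooth_fun_lin (a : R) (f g : M -> R) :
  smooth_fun f -> smooth_fun g -> smooth_fun (a *: f + g).
Proof.
by move=> fs gs c ac k; apply: Ck_lin;
  [exact: chart_im_open | exact: fs | exact: gs].
Qed.

Lemma smooth_fun_mul (f g : M -> R) :
  smooth_fun f -> smooth_fun g -> smooth_fun (f * g).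
Proof.
by move=> fs gs c ac k; apply: Ck_mul;
  [exact: chart_im_open | exact: fs | exact: gs].
Qed.

Lemma smooth_fun_subring : subring_closed (fun f : M -> R => `[< smooth_fun f >]).
Proof.
split=> [|f g|f g]; rewrite /in_mem /=.
- by apply/asboolP; exact: smooth_fun_cst.
- move=> /asboolP fs /asboolP gs; apply/asboolP.
  by rewrite addrC -scaleN1r; exact: smooth_fun_lin.
- by move=> /asboolP fs /asboolP gs; apply/asboolP; exact: smooth_fun_mul.
Qed.

HB.instance Definition _ :=
  GRing.SubChoice_isSubComPzRing.Build (M -> R) _ cinf smooth_fun_subring.

Lemma smooth_fun_submod :
  subsemimod_closed (fun f : M -> R => `[< smooth_fun f >]).
Proof.
split; first split.
- by apply/asboolP; exact: smooth_fun_cst.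
- move=> f g /asboolP fs /asboolP gs; apply/asboolP.
  by rewrite -[f]scale1r; exact: smooth_fun_lin.
- move=> a f /asboolP fs; apply/asboolP.
  by rewrite -[_ *: _]addr0; apply: smooth_fun_lin => //; exact: smooth_fun_cst.
Qed.

HB.instance Definition _ :=
  GRing.SubZmodule_isSubLmodule.Build R (M -> R) _ cinf smooth_fun_submod.

End SmoothFunctions.

Section VectorFields.
Context {R : realType} {n : nat} (M : smooth_manifold R n).
Local Notation A := (cinf M).

Definition is_derivation (X : A -> A) : Prop :=
  (forall (a : R) (f g : A), X (a *: f + g) = a *: X f + X g) /\
  (forall f g : A, X (f * g) = f * X g + g * X f).

(* A^o is A regarded as a module over itself. *)
Record vfield := VField {
  vfield_val :> A -> A^o ; _ : `[< is_derivation vfield_val >] }.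

HB.instance Definition _ := [isSub for vfield_val].
HB.instance Definition _ := [Choice of vfield by <:].

Lemma cinf_scalerAl (a : R) (f g : A) : (a *: f) * g = a *: (f * g).
Proof. by apply: val_inj; apply/funext => x; rewrite /=;
  exact/esym/mulrA. Qed.

Lemma cinf_scalerAr (a : R) (f g : A) : f * (a *: g) = a *: (f * g).
Proof. by rewrite mulrC cinf_scalerAl mulrC. Qed.

Lemma derivation_submod :
  subsemimod_closed (fun X : A -> A^o => `[< is_derivation X >]).
Proof.
split; first split.
- apply/asboolP; split=> [a f g|f g].
    by change (0 = a *: 0 + 0 :> A); rewrite scaler0 addr0.
  by change (0 = f * 0 + g * 0 :> A); rewrite !mulr0 addr0.
- move=> X Y /asboolP[Xl XM] /asboolP[Yl YM]; apply/asboolP.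
  split=> [a f g|f g]; rewrite addrfctE.
    change (X (a *: f + g) + Y (a *: f + g) =
            a *: ((X f : A) + Y f) + ((X g : A) + Y g) :> A).
    by rewrite Xl Yl scalerDr addrACA.
  change ((X (f * g) : A) + Y (f * g) =
          f * ((X g : A) + Y g) + g * ((X f : A) + Y f)).
  by rewrite XM YM; ring.
- move=> h X /asboolP[Xl XM]; apply/asboolP.
  split=> [a f g|f g].
    change (h * X (a *: f + g) = a *: (h * (X f : A)) + h * X g :> A).
    by rewrite Xl mulrDr cinf_scalerAr.
  change (h * X (f * g) = f * (h * X g) + g * (h * X f) :> A).
  by rewrite XM; ring.
Qed.

HB.instance Definition _ :=
  GRing.SubChoice_isSubLmodule.Build A (A -> A^o) _ vfield derivation_submod.

Lemma vfieldP (X : vfield) : is_derivation X.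
Proof. by case: X => X /= /asboolP. Qed.

Lemma vfieldD (X : vfield) (f g : A) : X (f + g) = X f + X g.
Proof. by have := (vfieldP X).1 1 f g; rewrite !scale1r. Qed.

Lemma vfieldZ (X : vfield) (a : R) (f : A) : X (a *: f) = a *: (X f : A).
Proof.
have X0 : X 0 = 0.
  by apply: (addrI (X 0)); rewrite -vfieldD addr0 addr0.
by have := (vfieldP X).1 a f 0; rewrite X0 !addr0.
Qed.

Lemma vfieldN (X : vfield) (f : A) : X (- f) = - X f.
Proof.
by have := vfieldZ X (-1) f; rewrite !scaleN1r.
Qed.

Lemma vfieldM (X : vfield) (f g : A) : X (f * g) = f * X g + g * X f :> A.
Proof. exact: (vfieldP X).2. Qed.

Lemma vfield_addE (X Y : vfield) (f : A) : (X + Y) f = X f + Y f :> A.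
Proof. by []. Qed.

Lemma vfield_scaleE (h : A) (X : vfield) (f : A) : (h *: X) f = h * X f :> A.
Proof. by []. Qed.

Lemma vfield_ext (X Y : vfield) : (forall f, X f = Y f) -> X = Y.
Proof. by move=> XY; apply: val_inj; apply/funext. Qed.

Record oneform := OneForm {
  oneform_val :> vfield -> A^o ; _ : `[< linear oneform_val >] }.

HB.instance Definition _ := [isSub for oneform_val].
HB.instance Definition _ := [Choice of oneform by <:].

Lemma linear_submod :
  subsemimod_closed (fun a : vfield -> A^o => `[< linear a >]).
Proof.
split; first split.
- by apply/asboolP => h X Y; change (0 = h * 0 + 0 :> A); rewrite mulr0 addr0.
- move=> a b /asboolP al /asboolP bl; apply/asboolP => h X Y.
  change (a (h *: X + Y) + b (h *: X + Y) =
          h *: (a X + b X) + (a Y + b Y)).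
  by rewrite al bl scalerDr addrACA.
- move=> k a /asboolP al; apply/asboolP => h X Y.
  change (k *: a (h *: X + Y) = h *: (k *: a X) + k *: a Y).
  by rewrite al scalerDr !scalerA [k * h]mulrC.
Qed.

HB.instance Definition _ :=
  GRing.SubChoice_isSubLmodule.Build A (vfield -> A^o) _ oneform linear_submod.

Lemma oneformP (a : oneform) : linear a.
Proof. by case: a => a /= /asboolP. Qed.

HB.instance Definition _ (a : oneform) :=
  GRing.isLinear.Build A vfield A^o *:%R a (oneformP a).

Lemma oneform_addE (a b : oneform) (X : vfield) : (a + b) X = a X + b X :> A.
Proof. by []. Qed.

Lemma oneform_scaleE (h : A) (a : oneform) (X : vfield) :
  (h *: a) X = h * a X :> A.
Proof. by []. Qed.

Lemma oneformD (a : oneform) X Y : a (X + Y) = a X + a Y :> A.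
Proof. by rewrite linearD. Qed.

Lemma oneformZ (a : oneform) (h : A) X : a (h *: X) = h * a X :> A.
Proof. by rewrite linearZ. Qed.

Lemma oneform_ext (a b : oneform) : (forall X, a X = b X) -> a = b.
Proof. by move=> ab; apply: val_inj; apply/funext. Qed.

Definition mk_oneform (a : vfield -> A^o) (al : linear a) : oneform :=
  OneForm (asboolT al).

Lemma lie_subproof (X Y : vfield) :
  is_derivation (fun f => X (Y f) - Y (X f) : A).
Proof.
split=> [a f g|f g].
  by rewrite !(vfieldD, vfieldZ) scalerBr opprD addrACA.
by rewrite !(vfieldM, vfieldD); ring.
Qed.

Definition lie (X Y : vfield) : vfield := VField (asboolT (lie_subproof X Y)).

Lemma lie_scalel (h : A) (X Y : vfield) :
  lie (h *: X) Y = h *: lie X Y - (Y h : A) *: X.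
Proof.
apply: vfield_ext => f.
change (h * X (Y f) - Y (h * X f) = h * (X (Y f) - Y (X f)) - Y h * X f :> A).
by rewrite vfieldM; ring.
Qed.

Lemma lie_scaler (h : A) (X Y : vfield) :
  lie X (h *: Y) = h *: lie X Y + (X h : A) *: Y.
Proof.
apply: vfield_ext => f.
change (X (h * Y f) - h * Y (X f) = h * (X (Y f) - Y (X f)) + X h * Y f :> A).
by rewrite vfieldM; ring.
Qed.

Lemma lieDl (X X' Y : vfield) : lie (X + X') Y = lie X Y + lie X' Y.
Proof.
apply: vfield_ext => f.
change (X (Y f) + X' (Y f) - Y ((X f : A) + X' f) =
  (X (Y f) - Y (X f)) + (X' (Y f) - Y (X' f)) :> A).
by rewrite vfieldD; ring.
Qed.

Lemma lieDr (X Y Y' : vfield) : lie X (Y + Y') = lie X Y + lie X Y'.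
Proof.
apply: vfield_ext => f.
change (X ((Y f : A) + Y' f) - (Y (X f) + Y' (X f)) =
  (X (Y f) - Y (X f)) + (X (Y' f) - Y' (X f)) :> A).
by rewrite vfieldD; ring.
Qed.

Lemma dfun_subproof (f : A) : linear (fun X : vfield => X f : A^o).
Proof. by []. Qed.

Definition dfun (f : A) : oneform := mk_oneform (dfun_subproof f).

Lemma lie_oneform_subproof (X : vfield) (a : oneform) :
  linear (fun Y : vfield => X (a Y) - a (lie X Y) : A^o).
Proof.
move=> h Y Z.
rewrite lieDr lie_scaler !(oneformD, oneformZ).
change (X (h * a Y + a Z) - (h * a (lie X Y) + X h * a Y + a (lie X Z)) =
  h * (X (a Y) - a (lie X Y)) + (X (a Z) - a (lie X Z)) :> A).
by rewrite vfieldD vfieldM; ring.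
Qed.

(* L_X a *)
Definition lie_oneform (X : vfield) (a : oneform) : oneform :=
  mk_oneform (lie_oneform_subproof X a).

(* A covariant 2-tensor field t is given by X |-> i(X)t; thus t X Y is the
   function t(X,Y), and t is its own flat map. *)
Local Notation tensor2 := {linear vfield -> oneform}.

Lemma tensor2_addl (t : tensor2) X Y Z : t (X + Y) Z = t X Z + t Y Z.
Proof. by rewrite linearD. Qed.

Lemma tensor2_scalel (t : tensor2) (h : A) X Z : t (h *: X) Z = h * t X Z :> A.
Proof. by rewrite linearZ. Qed.

Lemma tensor2_addr (t : tensor2) X Y Z : t X (Y + Z) = t X Y + t X Z.
Proof. by rewrite linearD. Qed.

Lemma tensor2_scaler (t : tensor2) (h : A) X Z : t X (h *: Z) = h * t X Z :> A.
Proof. by rewrite linearZ. Qed.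

Lemma lie_tensor2_subproof (Y : vfield) (t : tensor2) (X : vfield) :
  linear (fun Z : vfield =>
    Y (t X Z) - t (lie Y X) Z - t X (lie Y Z) : A^o).
Proof.
move=> h Z Z'.
rewrite lieDr lie_scaler !(tensor2_addr, tensor2_scaler).
change (Y (h * t X Z + t X Z') - (h * t (lie Y X) Z + t (lie Y X) Z')
    - (h * t X (lie Y Z) + Y h * t X Z + t X (lie Y Z')) =
  h * (Y (t X Z) - t (lie Y X) Z - t X (lie Y Z))
  + (Y (t X Z') - t (lie Y X) Z' - t X (lie Y Z')) :> A).
by rewrite vfieldD vfieldM; ring.
Qed.

(* i(X) L_Y t *)
Definition lie_tensor2 (Y : vfield) (t : tensor2) (X : vfield) : oneform :=
  mk_oneform (lie_tensor2_subproof Y t X).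

Lemma lie_tensor2_linear (Y : vfield) (t : tensor2) :
  linear (lie_tensor2 Y t).
Proof.
move=> h X X'; apply: oneform_ext => Z.
change (Y (t (h *: X + X') Z) - t (lie Y (h *: X + X')) Z
    - t (h *: X + X') (lie Y Z) =
  h * (Y (t X Z) - t (lie Y X) Z - t X (lie Y Z))
  + (Y (t X' Z) - t (lie Y X') Z - t X' (lie Y Z)) :> A).
rewrite lieDr lie_scaler !(tensor2_addl, tensor2_scalel) vfieldD vfieldM.
by ring.
Qed.

HB.instance Definition _ (Y : vfield) (t : tensor2) :=
  GRing.isLinear.Build A vfield oneform *:%R (lie_tensor2 Y t)
    (lie_tensor2_linear Y t).

Record twoform := TwoForm {
  twoform_val :> tensor2 ;
  twoform_alt : forall X, twoform_val X X = 0 }.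

Lemma twoform_skew (t : twoform) X Y : t X Y = - t Y X.
Proof.
apply/eqP; rewrite -addr_eq0; apply/eqP.
have := twoform_alt t (X + Y).
by rewrite tensor2_addl !tensor2_addr !twoform_alt addr0 add0r.
Qed.

Lemma dtwoform_subproof (t : twoform) (X Y : vfield) :
  linear (fun Z : vfield =>
    X (t Y Z) - Y (t X Z) + Z (t X Y)
    - t (lie X Y) Z + t (lie X Z) Y - t (lie Y Z) X : A^o).
Proof.
move=> h Z Z'.
change (X (t Y (h *: Z + Z')) - Y (t X (h *: Z + Z')) + (h *: Z + Z') (t X Y)
    - t (lie X Y) (h *: Z + Z') + t (lie X (h *: Z + Z')) Y
    - t (lie Y (h *: Z + Z')) X =
  h * (X (t Y Z) - Y (t X Z) + Z (t X Y)
    - t (lie X Y) Z + t (lie X Z) Y - t (lie Y Z) X)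
  + (X (t Y Z') - Y (t X Z') + Z' (t X Y)
    - t (lie X Y) Z' + t (lie X Z') Y - t (lie Y Z') X) :> A).
rewrite !lieDr !lie_scaler !(tensor2_addl, tensor2_addr, tensor2_scalel,
  tensor2_scaler, vfieldD, vfieldM, vfield_addE, vfield_scaleE).
rewrite [t Z Y]twoform_skew [t Z X]twoform_skew.
by ring.
Qed.

(* i(X /\ Y) dt *)
Definition contract_d (t : twoform) (X Y : vfield) : oneform :=
  mk_oneform (dtwoform_subproof t X Y).

Definition vfield_vanishes (X : vfield) (p : M) : Prop :=
  forall f : A, (X f : A) p = 0.

Definition oneform_vanishes (a : oneform) (p : M) : Prop :=
  forall X : vfield, (a X : A) p = 0.

Record riemannian_metric := RiemannianMetric {
  riem_val :> tensor2 ;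
  riem_sym : forall X Y, riem_val X Y = riem_val Y X ;
  riem_posdef : forall X p, ~ vfield_vanishes X p ->
    0 < (riem_val X X : A) p }.

End VectorFields.

(* Complexification V (x) C of a module of sections: (x, y) stands for
   x + sqrt(-1) y. *)
Definition cplx (V : Type) : Type := (V * V)%type.
HB.instance Definition _ (V : zmodType) := GRing.Zmodule.on (cplx V).
HB.instance Definition _ (K : pzRingType) (V : lmodType K) :=
  GRing.Lmodule.on (cplx V).

Section Complexification.

(* z |-> sqrt(-1) z *)
Definition mul_i (V : zmodType) (z : cplx V) : cplx V := (- z.2, z.1).

(* P (x) C, for P the sections of a real subbundle *)
Definition csub (V : Type) (P : V -> Prop) (z : cplx V) : Prop :=
  P z.1 /\ P z.2.

(* complex (bi)linear extensions *)
Definition clin (V W : Type) (f : V -> W) (z : cplx V) : cplx W :=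
  (f z.1, f z.2).

Definition cbilin (U V : Type) (W : zmodType) (b : U -> V -> W)
    (x : cplx U) (y : cplx V) : cplx W :=
  (b x.1 y.1 - b x.2 y.2, b x.1 y.2 + b x.2 y.1).

End Complexification.

Section GeneralizedGeometry.
Context {R : realType} {n : nat} (M : smooth_manifold R n).
Local Notation A := (cinf M).
Local Notation vfield := (vfield M).
Local Notation oneform := (oneform M).

(* sections of TM (+) T*M *)
Definition bigT : Type := (vfield * oneform)%type.
HB.instance Definition _ := GRing.Lmodule.on bigT.

Definition pairing (x y : bigT) : A :=
  (2^-1 : R) *: ((x.2 y.1 : A) + y.2 x.1).

Definition courant (x y : bigT) : bigT :=
  (lie x.1 y.1,
   lie_oneform x.1 y.2 - lie_oneform y.1 x.2
   + dfun ((2^-1 : R) *: ((x.2 y.1 : A) - y.2 x.1))).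

Definition bigT_vanishes (x : bigT) (p : M) : Prop :=
  vfield_vanishes x.1 p /\ oneform_vanishes x.2 p.

(* G comes together with its operator sharp_G, which is determined by G. *)
Record gen_metric := GenMetric {
  gm_form :> bigT -> bigT -> A ;
  gm_sharp : bigT -> bigT ;
  gm_linear : forall x, linear (gm_form x : bigT -> A^o) ;
  gm_sym : forall x y, gm_form x y = gm_form y x ;
  gm_posdef : forall x p, ~ bigT_vanishes x p -> 0 < gm_form x x p ;
  gm_sharpE : forall x y, pairing (gm_sharp x) y *+ 2 = gm_form x y ;
  gm_sharpK : forall x, gm_sharp (gm_sharp x) = x ;
  gm_sharp_pairing : forall x y,
    pairing (gm_sharp x) (gm_sharp y) = pairing x y }.

(* The sign +/- is (-1) ^+ s for s : bool, so s = false is + and s = true is -. *)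

(* i(X)(psi + s gamma) *)
Definition flat_pm (psi : twoform M) (gamma : riemannian_metric M) (s : bool)
    (X : vfield) : oneform := psi X + (-1) ^+ s *: gamma X.

Definition inV (G : gen_metric) (s : bool) (x : bigT) : Prop :=
  gm_sharp G x = (-1) ^+ s *: x.

(* (gamma, psi) is the pair associated with G. *)
Definition associated (G : gen_metric) (gamma : riemannian_metric M)
    (psi : twoform M) : Prop :=
  forall s x, inV G s x <-> x.2 = flat_pm psi gamma s x.1.

Definition gen_F_structure (Phi : {linear bigT -> bigT}) : Prop :=
  (forall x y, pairing (Phi x) y + pairing x (Phi y) = 0) /\
  (forall x, Phi (Phi (Phi x)) + Phi x = 0).

Definition inE (Phi : {linear bigT -> bigT}) (z : cplx bigT) : Prop :=
  clin Phi z = mul_i z.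

Definition inS (Phi : {linear bigT -> bigT}) (z : cplx bigT) : Prop :=
  clin Phi z = 0.

Definition gen_CRF (Phi : {linear bigT -> bigT}) : Prop :=
  gen_F_structure Phi /\
  forall z w, inE Phi z -> inE Phi w -> inE Phi (cbilin courant z w).

Definition gen_metric_CRF (Phi : {linear bigT -> bigT}) (G : gen_metric) :
    Prop :=
  gen_CRF Phi /\ (forall x y, G (Phi x) y + G x (Phi y) = 0).

Definition inEs (Phi : {linear bigT -> bigT}) (G : gen_metric) (s : bool)
    (z : cplx bigT) : Prop := csub (inV G s) z /\ inE Phi z.

Definition inSs (Phi : {linear bigT -> bigT}) (G : gen_metric) (s : bool)
    (z : cplx bigT) : Prop := csub (inV G s) z /\ inS Phi z.

(* For a generalized metric F-structure (Phi, G). *)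
Definition gen_CRFK (Phi : {linear bigT -> bigT}) (G : gen_metric) : Prop :=
  forall s,
  (forall z w, inEs Phi G s z -> inEs Phi G s w ->
     inEs Phi G s (cbilin courant z w)) /\
  (forall z w, inEs Phi G s z -> inSs Phi G s w ->
     exists u v, [/\ inEs Phi G s u, inSs Phi G s v &
                     cbilin courant z w = u + v]).

Definition tau_inv (gamma : riemannian_metric M) (psi : twoform M) (s : bool)
    (X : vfield) : bigT := (X, flat_pm psi gamma s X).

Definition F_pm (Phi : {linear bigT -> bigT}) (gamma : riemannian_metric M)
    (psi : twoform M) (s : bool) (X : vfield) : vfield :=
  (Phi (tau_inv gamma psi s X)).1.

Lemma F_pm_linear Phi gamma psi s : linear (F_pm Phi gamma psi s).
Proof.
move=> h X Y; rewrite /F_pm.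
have -> : tau_inv gamma psi s (h *: X + Y) =
    h *: tau_inv gamma psi s X + tau_inv gamma psi s Y.
  congr pair; rewrite /flat_pm !linearP.
  change (h *: psi X + psi Y +
    (h *: ((-1) ^+ s *: gamma X) + (-1) ^+ s *: gamma Y) =
    h *: (psi X + (-1) ^+ s *: gamma X) + (psi Y + (-1) ^+ s *: gamma Y)).
  by rewrite scalerDr addrACA.
by rewrite linearP.
Qed.

HB.instance Definition _ Phi gamma psi s :=
  GRing.isLinear.Build A vfield vfield *:%R (F_pm Phi gamma psi s)
    (F_pm_linear Phi gamma psi s).

Definition inH (F : {linear vfield -> vfield}) (Z : cplx vfield) : Prop :=
  clin F Z = mul_i Z.

Definition inQ (F : {linear vfield -> vfield}) (Z : cplx vfield) : Prop :=
  clin F Z = 0.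

Definition classical_metric_CRF (F : {linear vfield -> vfield})
    (gamma : riemannian_metric M) : Prop :=
  [/\ (forall X, F (F (F X)) + F X = 0),
      (forall X Y, gamma (F X) Y + gamma X (F Y) = 0),
      (forall Z W, inH F Z -> inH F W -> inH F (cbilin (@lie R n M) Z W)) &
      (forall Z W, inH F Z -> inQ F W ->
         exists U V, [/\ inH F U, inQ F V & cbilin (@lie R n M) Z W = U + V])].

End GeneralizedGeometry.

(* Main.v *)
(** Along the graph [V_s] of [psi + s gamma], the Courant bracket of the lifts
    of [X] and [Y] is the lift of [[X, Y]] plus the 1-form
    [i(X /\ Y) d psi - s (i(X) L_Y gamma - L_X i(Y) gamma)].  Since [Phi]
    commutes with [sharp_G], the lift intertwines [F_s] with [Phi], so it
    identifies [H_s], [Q_s] with [E_s], [S_s]; a Courant bracket then stays in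
    [V_s] exactly when the 1-form vanishes. *)
Require Import Defs.
From HB Require Import structures.
From mathcomp Require Import all_boot all_order all_algebra.
From mathcomp Require Import boolp classical_sets functions cardinality reals.
From mathcomp Require Import topology normedtype derive.
From mathcomp Require Import ring.
Import GRing.Theory.
Local Open Scope ring_scope.

Set Implicit Arguments.
Unset Strict Implicit.
Unset Printing Implicit Defensive.

(** * Complex bilinear extensions of combined maps *)

Section Complexification.

(** The coefficient is real, so it acts on real and imaginary parts separately. With [k] the sign
    [(-1) ^+ s] this splits the complexified [bracket_defect]. *)
Lemma cbilin_sub_scale (K : pzRingType) (U V : Type) (W : lmodType K)
    (b c : U -> V -> W) (k : K) x y :
  cbilin (fun u v => b u v - k *: c u v) x y =
  cbilin b x y - k *: cbilin c x y.
Proof.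
congr pair => /=; rewrite (scalerBr, scalerDr) !opprD ?opprK;
  by rewrite addrACA.
Qed.

(** Serves to split the complexified Courant bracket of two lifts, with [f] the lift and [g] the
    inclusion of 1-forms. *)
Lemma cbilin_clin_add (U V : Type) (W1 W2 W : zmodType)
    (f : {additive W1 -> W}) (g : {additive W2 -> W})
    (b1 : U -> V -> W1) (b2 : U -> V -> W2) x y :
  cbilin (fun u v => f (b1 u v) + g (b2 u v)) x y =
  clin f (cbilin b1 x y) + clin g (cbilin b2 x y).
Proof.
by congr pair => /=; rewrite ?raddfB ?raddfD ?opprD addrACA.
Qed.

End Complexification.

(** * Nondegeneracy of the pairing *)

Section Pairing.
Context {R : realType} {n : nat} (M : smooth_manifold R n).
Local Notation A := (cinf M).
Local Notation bigT := (bigT M).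

Lemma half_double (V : lmodType R) (v : V) : (2^-1 : R) *: (v + v) = v.
Proof.
rewrite -mulr2n -scaler_nat scalerA mulVf ?scale1r //.
by rewrite Num.Theory.pnatr_eq0.
Qed.

Lemma pairing_double (x y : bigT) : pairing x y *+ 2 = (x.2 y.1 : A) + y.2 x.1.
Proof. by rewrite mulr2n -scalerDr half_double. Qed.

(** No local frame is involved: a vector field is a derivation, so pairing with [(0, dfun f)] for
    all [f] recovers it, and pairing with [(Z, 0)] recovers the 1-form. *)
Lemma pairing_nondegenerate (x y : bigT) :
  (forall z, pairing x z = pairing y z) -> x = y.
Proof.
move=> xy.
have e (z : bigT) : (x.2 z.1 : A) + z.2 x.1 = (y.2 z.1 : A) + z.2 y.1.
  by have := congr1 (fun f => f *+ 2) (xy z); rewrite !pairing_double.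
case: x y e {xy} => [X a] [Y b] /= e; congr pair.
  apply: vfield_ext => f.
  have := e (0, dfun f); rewrite /= !linear0.
  by rewrite !add0r.
apply: oneform_ext => Z; have := e (Z, 0) => /=.
change ((a Z : A) + 0 = b Z + 0 -> a Z = b Z).
by rewrite !addr0.
Qed.

End Pairing.

(** * The Courant bracket on the graph of [psi + s gamma] *)

Section Lift.
Context {R : realType} {n : nat} (M : smooth_manifold R n).
Variables (gamma : riemannian_metric M) (psi : twoform M) (s : bool).
Local Notation A := (cinf M).
Local Notation vfield := (vfield M).
Local Notation tau := (tau_inv gamma psi s).

Lemma flat_pmE (X Y : vfield) :
  flat_pm psi gamma s X Y = psi X Y + (-1) ^+ s * gamma X Y :> A.
Proof. by []. Qed.

Lemma tau_inv_is_linear : linear (tau : vfield -> bigT M).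
Proof.
move=> h X Y; congr pair; apply: oneform_ext => Z.
change (flat_pm psi gamma s (h *: X + Y) Z =
  h * flat_pm psi gamma s X Z + flat_pm psi gamma s Y Z :> A).
rewrite !flat_pmE !(tensor2_addl, tensor2_scalel).
by ring.
Qed.

HB.instance Definition _ :=
  GRing.isLinear.Build A vfield (bigT M) *:%R tau tau_inv_is_linear.

(** Only a function of two fields, not a tensor: replacing [X] by [h *: X] adds a multiple of
    [gamma(X, Y) dh]. [cbilin] asks for no linearity. *)
Definition bracket_defect (X Y : vfield) : oneform M :=
  contract_d psi X Y -
  (-1) ^+ s *: (lie_tensor2 Y gamma X - lie_oneform X (gamma Y)).

Lemma vfield_sign (X : vfield) (f : A) :
  X ((-1) ^+ s * f) = (-1) ^+ s * X f :> A.
Proof. by rewrite !mulr_sign; case: s; rewrite ?vfieldN. Qed.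

(** The [psi] terms and the exact term add up to [i([X,Y]) psi + i(X /\ Y) d psi] by Cartan
    calculus. For [gamma], the identity [L_Y i(X) gamma = i(X) L_Y gamma - i([X,Y]) gamma] isolates
    the lift of the bracket. *)
Lemma courant_tau_inv (X Y : vfield) :
  courant (tau X) (tau Y) = tau (lie X Y) + (0, bracket_defect X Y).
Proof.
congr pair; first by rewrite addr0.
(* In the exact term of the Courant bracket the symmetric [gamma] cancels and the skew [psi]
   doubles. *)
have half : (2^-1 : R) *:
    ((flat_pm psi gamma s X Y : A) - flat_pm psi gamma s Y X) = psi X Y :> A.
  rewrite !flat_pmE [psi Y X]twoform_skew [gamma Y X]riem_sym.
  by rewrite opprD !opprK addrACA subrr addr0 half_double.
apply: oneform_ext => Z.
rewrite /= half.
change (X (flat_pm psi gamma s Y Z) - flat_pm psi gamma s Y (lie X Z) -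
  (Y (flat_pm psi gamma s X Z) - flat_pm psi gamma s X (lie Y Z)) + Z (psi X Y)
  = flat_pm psi gamma s (lie X Y) Z +
   (X (psi Y Z) - Y (psi X Z) + Z (psi X Y)
    - psi (lie X Y) Z + psi (lie X Z) Y - psi (lie Y Z) X -
   (-1) ^+ s * (Y (gamma X Z) - gamma (lie Y X) Z - gamma X (lie Y Z) -
     (X (gamma Y Z) - gamma Y (lie X Z)))) :> A).
rewrite !flat_pmE !vfieldD !vfield_sign.
(* [ring] treats values of forms as atoms, so brackets and arguments are first put in one order. *)
have -> : lie Y X = - lie X Y.
  by apply: vfield_ext => f; exact: (esym (opprB _ _)).
have -> : gamma (- lie X Y) Z = - gamma (lie X Y) Z :> A by rewrite linearN.
rewrite [psi (lie X Z) Y]twoform_skew [psi (lie Y Z) X]twoform_skew.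
by ring.
Qed.

(** Here [psi] cancels by skewness. So [g] restricted to [V_s] is [s gamma], which turns
    [g]-skewness of [Phi] into [gamma]-skewness of [F_s]. *)
Lemma pairing_tau_inv (X Y : vfield) :
  pairing (tau X) (tau Y) = (-1) ^+ s * gamma X Y.
Proof.
rewrite /pairing /=.
change ((2^-1 : R) *:
    ((flat_pm psi gamma s X Y : A) + flat_pm psi gamma s Y X) = (-1) ^+ s * gamma X Y).
rewrite !flat_pmE [psi Y X]twoform_skew [gamma Y X]riem_sym.
by rewrite addrACA subrr add0r half_double.
Qed.

Lemma bracket_defect_eq0 (Z W : cplx vfield) :
  cbilin bracket_defect Z W = 0 <->
  cbilin (contract_d psi) Z W =
  (-1) ^+ s *:
    cbilin (fun X Y => lie_tensor2 Y gamma X - lie_oneform X (gamma Y)) Z W.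
Proof.
rewrite cbilin_sub_scale.
by split=> [/eqP|->]; rewrite ?subrr // subr_eq0 => /eqP.
Qed.

(** Named so that it can carry the linear structure that [cbilin_clin_add] requires. *)
Definition of_oneform (a : oneform M) : bigT M := (0, a).

Lemma of_oneform_is_linear : linear of_oneform.
Proof.
by move=> h a b; congr pair; exact: (esym (etrans (addr0 _) (scaler0 _ h))).
Qed.

HB.instance Definition _ :=
  GRing.isLinear.Build A (oneform M) (bigT M) *:%R of_oneform
    of_oneform_is_linear.

Lemma cbilin_courant_tau_inv (Z W : cplx vfield) :
  cbilin (@courant R n M) (clin tau Z) (clin tau W) =
  clin tau (cbilin (@lie R n M) Z W) +
  clin of_oneform (cbilin bracket_defect Z W).
Proof.
rewrite -cbilin_clin_add.
by congr pair => /=; rewrite !courant_tau_inv.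
Qed.

End Lift.

(** * Transfer of eigenbundles and integrability along the lift *)

Section MetricFStructure.
Context {R : realType} {n : nat} (M : smooth_manifold R n).
Variables (Phi : {linear bigT M -> bigT M}) (G : gen_metric M).
Variables (gamma : riemannian_metric M) (psi : twoform M) (s : bool).
Hypothesis Phi_F : gen_F_structure Phi.
Hypothesis Phi_G : forall x y, G (Phi x) y + G x (Phi y) = 0.
Hypothesis G_assoc : associated G gamma psi.
Local Notation bigT := (bigT M).
Local Notation vfield := (vfield M).
Local Notation tau := (tau_inv gamma psi s).
Local Notation F := (F_pm Phi gamma psi s).

Lemma pairing_sharp (x y : bigT) :
  pairing (gm_sharp G x) y = (2^-1 : R) *: G x y.
Proof. by rewrite -gm_sharpE mulr2n half_double. Qed.

(** [Phi] is skew for both [G] and [g]: moving it across each in turn gives [2g(sharp Phi x, z) =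
    -G(x, Phi z) = -2g(sharp x, Phi z) = 2g(Phi sharp x, z)], and [g] is nondegenerate. *)
Lemma sharp_commutes (x : bigT) : gm_sharp G (Phi x) = Phi (gm_sharp G x).
Proof.
apply: pairing_nondegenerate => z.
rewrite pairing_sharp (eqP (_ : G (Phi x) z == - G x (Phi z))); last first.
  by rewrite -addr_eq0 Phi_G.
rewrite scalerN -pairing_sharp; apply/eqP; rewrite eq_sym -addr_eq0.
by rewrite Phi_F.1.
Qed.

Lemma inV_tau_inv (X : vfield) : inV G s (tau X).
Proof. exact/G_assoc. Qed.

Lemma inVP (x : bigT) : inV G s x -> x = tau x.1.
Proof. by case: x => X a /G_assoc /= ->. Qed.

(** Commuting with [sharp_G], [Phi] preserves [V_s], where an element is the lift of its vector
    part. *)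
Lemma Phi_tau_inv (X : vfield) : Phi (tau X) = tau (F X).
Proof.
by apply: inVP; rewrite /inV sharp_commutes inV_tau_inv linearZ.
Qed.

Lemma F_pm_cube (X : vfield) : F (F (F X)) + F X = 0.
Proof. by have := congr1 fst (Phi_F.2 (tau X)); rewrite !Phi_tau_inv. Qed.

Lemma F_pm_skew (X Y : vfield) : gamma (F X) Y + gamma X (F Y) = 0.
Proof.
have := Phi_F.1 (tau X) (tau Y).
rewrite !Phi_tau_inv !pairing_tau_inv -mulrDr mulr_sign.
by case: s => // /eqP; rewrite oppr_eq0 => /eqP.
Qed.

Lemma csub_inV_clin (Z : cplx vfield) : csub (inV G s) (clin tau Z).
Proof. by split; exact: inV_tau_inv. Qed.

Lemma csub_inVP (z : cplx bigT) : csub (inV G s) z -> z = clin tau (clin fst z).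
Proof. by case: z => x y [/= /inVP-> /inVP->]. Qed.

Lemma clin_tau_inv_inj : injective (clin tau).
Proof.
by move=> [X Y] [X' Y'] e; exact: (congr1 (clin fst) e).
Qed.

Lemma clin_Phi_tau_inv (Z : cplx vfield) :
  clin Phi (clin tau Z) = clin tau (clin F Z).
Proof. by rewrite /clin /= !Phi_tau_inv. Qed.

Lemma inE_clin (Z : cplx vfield) : Defs.inE Phi (clin tau Z) <-> inH F Z.
Proof.
rewrite /Defs.inE clin_Phi_tau_inv.
have -> : mul_i (clin tau Z) = clin tau (mul_i Z) by rewrite /clin /= raddfN.
by split=> [/clin_tau_inv_inj|->].
Qed.

Lemma inS_clin (Z : cplx vfield) : inS Phi (clin tau Z) <-> inQ F Z.
Proof.
rewrite /inS clin_Phi_tau_inv.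
have -> : 0 = clin tau 0 by rewrite /clin /= raddf0.
by split=> [/clin_tau_inv_inj|->].
Qed.

Lemma inEs_clin (Z : cplx vfield) : inEs Phi G s (clin tau Z) <-> inH F Z.
Proof.
by rewrite /inEs inE_clin; split=> [[]//|ZH]; split=> //; exact: csub_inV_clin.
Qed.

Lemma inSs_clin (Z : cplx vfield) : inSs Phi G s (clin tau Z) <-> inQ F Z.
Proof.
by rewrite /inSs inS_clin; split=> [[]//|ZH]; split=> //; exact: csub_inV_clin.
Qed.

Lemma clin_tau_invD (Z W : cplx vfield) :
  clin tau (Z + W) = clin tau Z + clin tau W.
Proof. by congr pair; rewrite raddfD. Qed.

(** [V_s] is a graph over [TM]: the vector part [X] already determines the 1-form part, leaving no
    room for [a]. *)
Lemma tau_inv_add_inV (X : vfield) (a : oneform M) :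
  inV G s (tau X + of_oneform a) -> a = 0.
Proof.
move/inVP; rewrite [(tau X + _).1]addr0 => e.
apply: (congr1 snd (_ : of_oneform a = 0)).
by apply: (addrI (tau X)); rewrite addr0.
Qed.

Lemma courant_inV (Z W : cplx vfield) :
  csub (inV G s) (cbilin (@courant R n M) (clin tau Z) (clin tau W)) ->
  cbilin (bracket_defect gamma psi s) Z W = 0.
Proof.
rewrite cbilin_courant_tau_inv.
case: (cbilin (bracket_defect _ _ _) _ _) => a b [].
by move=> /tau_inv_add_inV /= -> /tau_inv_add_inV /= ->.
Qed.

Lemma cbilin_courant_lift (Z W : cplx vfield) :
  cbilin (bracket_defect gamma psi s) Z W = 0 ->
  cbilin (@courant R n M) (clin tau Z) (clin tau W) =
  clin tau (cbilin (@lie R n M) Z W).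
Proof. by rewrite cbilin_courant_tau_inv => ->; exact: addr0. Qed.

(** The two signs do not interact, so the equivalence is proved for one fixed [s]. *)
Lemma gen_CRFK_classical :
  ((forall z w, inEs Phi G s z -> inEs Phi G s w ->
      inEs Phi G s (cbilin (@courant R n M) z w)) /\
   (forall z w, inEs Phi G s z -> inSs Phi G s w ->
      exists u v, [/\ inEs Phi G s u, inSs Phi G s v &
                      cbilin (@courant R n M) z w = u + v])) <->
  classical_metric_CRF F gamma /\
  (forall X Y : cplx vfield, (inH F X /\ inH F Y) \/ (inH F X /\ inQ F Y) ->
     cbilin (bracket_defect gamma psi s) X Y = 0).
Proof.
split=> [[EE ES]|[[_ _ HH HQ] def0]].
  (* Vanishing of the defect comes first: only then is the Courant bracket the lift of the Lie
     bracket, so that closure can descend. *)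
  have HHV Z W : inH F Z -> inH F W ->
      cbilin (bracket_defect gamma psi s) Z W = 0.
    move=> /inEs_clin ZE /inEs_clin WE.
    by apply: courant_inV; have [] := EE _ _ ZE WE.
  have HQV Z W : inH F Z -> inQ F W ->
      cbilin (bracket_defect gamma psi s) Z W = 0.
    move=> /inEs_clin ZE /inSs_clin WS; apply: courant_inV.
    (* Both summands lie in [V_s], so their sum is again a lift. *)
    have [u [v [[/csub_inVP-> _] [/csub_inVP-> _] ->]]] := ES _ _ ZE WS.
    by rewrite -clin_tau_invD; exact: csub_inV_clin.
  split; last by move=> X Y [[]|[]]; [exact: HHV | exact: HQV].
  split; [exact: F_pm_cube | exact: F_pm_skew | |] => Z W ZH WH.
    apply/inEs_clin; rewrite -cbilin_courant_lift; last exact: HHV.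
    by apply: EE; exact/inEs_clin.
  have := ES _ _ ((inEs_clin Z).2 ZH) ((inSs_clin W).2 WH).
  rewrite cbilin_courant_lift; last exact: HQV.
  (* The vector parts of [u] and [v] decompose the Lie bracket, because the lift is additive and
     injective. *)
  move=> [u [v [uE vS]]]; move: (uE) (vS).
  rewrite (csub_inVP uE.1) (csub_inVP vS.1) -clin_tau_invD.
  move=> /inEs_clin uH /inSs_clin vQ /clin_tau_inv_inj e.
  by exists (clin fst u), (clin fst v).
(* Conversely, sections of [E_s] and [S_s] are lifts of their vector parts; with zero defect,
   closure under the Lie bracket lifts back. *)
split=> z w zE wE; move: (zE) (wE); rewrite (csub_inVP zE.1) (csub_inVP wE.1).
  move=> /inEs_clin zH /inEs_clin wH.
  rewrite cbilin_courant_lift; last by apply: def0; left.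
  by apply/inEs_clin; exact: HH.
move=> /inEs_clin zH /inSs_clin wQ.
rewrite cbilin_courant_lift; last by apply: def0; right.
have [U [V [/inEs_clin UE /inSs_clin VS ->]]] := HQ _ _ zH wQ.
by exists (clin tau U), (clin tau V); rewrite clin_tau_invD.
Qed.

End MetricFStructure.

Theorem proposition4p4 (R : realType) (n : nat) (M : smooth_manifold R n)
    (Phi : {linear bigT M -> bigT M}) (G : gen_metric M)
    (gamma : riemannian_metric M) (psi : twoform M) :
  gen_metric_CRF Phi G -> associated G gamma psi ->
  (gen_CRFK Phi G <->
   (forall s : bool, classical_metric_CRF (F_pm Phi gamma psi s) gamma) /\
   (forall (s : bool) (X Y : cplx (vfield M)),
      (inH (F_pm Phi gamma psi s) X /\ inH (F_pm Phi gamma psi s) Y) \/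
      (inH (F_pm Phi gamma psi s) X /\ inQ (F_pm Phi gamma psi s) Y) ->
      cbilin (contract_d psi) X Y =
      (-1) ^+ s *:
        cbilin (fun X Y => lie_tensor2 Y gamma X - lie_oneform X (gamma Y))
               X Y)).
Proof.
move=> [[PhiF _] PhiG] Gassoc.
have CRFK s := gen_CRFK_classical s PhiF PhiG Gassoc.
split=> [K|[cl eqs] s].
  split=> s; have [cl d0] := (CRFK s).1 (K s) => // X Y XY.
  exact: (bracket_defect_eq0 gamma psi s X Y).1 (d0 X Y XY).
apply: (CRFK s).2; split=> // X Y XY.
exact: (bracket_defect_eq0 gamma psi s X Y).2 (eqs s X Y XY).
Qed.
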